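(* Let $\mathcal M$ denote the greatest fixed point (with respect to inclusion) of $\mathcal F^{-1}:2^{\mathcal X}\to2^{\mathcal X}$, and let $\mathcal P\in 2^{\mathcal X}$ satisfy $\mathcal M\subseteq\mathcal P$ and $\mathcal F^{-1}(\mathcal P)\subseteq\mathcal P$. Consider the sequence $\{\mathcal P_k\}_{k\in\mathbb N}$ defined by $\mathcal P_0:=\mathcal P$ and $\mathcal P_{k+1}:=\mathcal F^{-1}(\mathcal P_k)$ for $k\in\mathbb N$. Then: (i) the sequence is decreasing and contains $\mathcal M$, namely $\mathcal M\subseteq\mathcal P_{k+1}\subseteq\mathcal P_k$ for all $k\in\mathbb N$; (ii) the intersection of the sequence equals $\mathcal M$, namely $\mathcal M=\mathcal P_\infty:=\bigcap_{k\in\mathbb N}\mathcal P_k$.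
   Context: $\mathbb N$ denotes the nonnegative integers. Let $\mathscr A\subseteq\mathbb R^{n\times n}$ be a nonempty family of matrices, $\mathcal W\subseteq\mathbb R^n$ a nonempty set, and $\mathcal X\subseteq\mathbb R^n$ a set. Put $\mathcal F(x):=\{Ax+w: A\in\mathscr A,\ w\in\mathcal W\}$ for $x\in\mathbb R^n$. For $\mathcal S\subseteq\mathbb R^n$ the robust predecessor set is $\mathcal F^{-1}(\mathcal S):=\{x\in\mathbb R^n:\mathcal F(x)\subseteq\mathcal S\}\cap\mathcal X$; the robust predecessor operator is its restriction to a self-map of the power set $2^{\mathcal X}$. This operator has a greatest fixed point with respect to inclusion. *)

(* Defs.v *)
From HB Require Import structures.
From mathcomp Require Import all_boot all_order all_algebra.
From mathcomp Require Import classical_sets reals.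

Set Implicit Arguments.
Unset Strict Implicit.
Unset Printing Implicit Defensive.

Local Open Scope classical_set_scope.
Local Open Scope ring_scope.

Definition successors (R : realType) (n : nat)
    (AA : set 'M[R]_n) (W : set 'cV[R]_n) (x : 'cV[R]_n) : set 'cV[R]_n :=
  [set A *m x + w | A in AA & w in W].

Definition robust_pred (R : realType) (n : nat)
    (AA : set 'M[R]_n) (W X : set 'cV[R]_n) (S : set 'cV[R]_n) :
    set 'cV[R]_n :=
  [set x | successors AA W x `<=` S] `&` X.

(* [f] is viewed as a self-map of the power set of [X]; the members of that
   power set are the [S : set T] with [S `<=` X]. *)
Definition is_greatest_fixpoint (T : Type) (X : set T) (f : set T -> set T)
    (M : set T) : Prop :=
  [/\ M `<=` X, f M = M & forall S, S `<=` X -> f S = S -> S `<=` M].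

(* Main.v *)
Require Import Defs.
From HB Require Import structures.
From mathcomp Require Import all_boot all_order all_algebra.
From mathcomp Require Import classical_sets reals.

(** The predecessor operator is monotone and, since [successors x `<=` S] is
    a universal condition on [S], it even commutes with nonempty
    intersections ([robust_pred_bigcap]).  Monotonicity propagates the two
    initial inclusions [M `<=` P] and [robust_pred P `<=` P] along the
    iteration, which gives (i).  For (ii), commutation shows that applying the
    operator to the intersection of the iterates only drops the first iterate,
    which is harmless for a decreasing sequence ([bigcap_shift]); hence the
    intersection is a fixed point, and so lies below the greatest one. *)

Local Open Scope classical_set_scope.
Local Open Scope ring_scope.

Lemma robust_pred_mono (R : realType) (n : nat)
    (AA : set 'M[R]_n) (W X S T : set 'cV[R]_n) :
  S `<=` T -> robust_pred AA W X S `<=` robust_pred AA W X T.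
Proof. by move=> sST x [sxS Xx]; split=> // y /sxS /sST. Qed.

(** The predecessor condition on a point is universal over its successors, so
    it can be exchanged with the intersection.  Nonemptiness of the family
    matters for the constraint set: the empty intersection is the whole space,
    whose predecessor set is only [X]. *)
Lemma robust_pred_bigcap (R : realType) (n : nat)
    (AA : set 'M[R]_n) (W X : set 'cV[R]_n)
    (I : Type) (D : set I) (S_ : I -> set 'cV[R]_n) :
  D !=set0 ->
  robust_pred AA W X (\bigcap_(i in D) S_ i) =
  \bigcap_(i in D) robust_pred AA W X (S_ i).
Proof.
move=> [i0 Di0]; apply/seteqP; split=> x.
  by move=> [sxS Xx] i Di; split=> // y /sxS; apply.
move=> predx; split; last by case: (predx i0 Di0).
by move=> y succ_xy i Di; case: (predx i Di) => + _; apply.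
Qed.

Lemma bigcap_shift (T : Type) (S_ : nat -> set T) :
  (forall k, S_ k.+1 `<=` S_ k) ->
  \bigcap_(k in [set: nat]) S_ k.+1 = \bigcap_(k in [set: nat]) S_ k.
Proof.
move=> S_decr; apply/seteqP; split=> x Sx k _; last exact: Sx.
by apply: S_decr; apply: Sx.
Qed.

Theorem theorem2 (R : realType) (n : nat)
    (AA : set 'M[R]_n) (W X : set 'cV[R]_n)
    (AA_nonempty : AA !=set0) (W_nonempty : W !=set0)
    (M : set 'cV[R]_n)
    (M_gfp : is_greatest_fixpoint X (robust_pred AA W X) M)
    (P : set 'cV[R]_n)
    (P_sub_X : P `<=` X) (M_sub_P : M `<=` P)
    (pred_P_sub_P : robust_pred AA W X P `<=` P)
    (P_ : nat -> set 'cV[R]_n)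
    (P_0 : P_ 0%N = P)
    (P_S : forall k : nat, P_ k.+1 = robust_pred AA W X (P_ k)) :
  (forall k : nat, M `<=` P_ k.+1 /\ P_ k.+1 `<=` P_ k) /\
  M = \bigcap_(k in [set: nat]) P_ k.
Proof.
case: M_gfp => _ M_fix M_greatest.
have M_sub k : M `<=` P_ k.
  elim: k => [|k IHk]; first by rewrite P_0.
  by rewrite P_S -M_fix; apply: robust_pred_mono.
have P_decr k : P_ k.+1 `<=` P_ k.
  elim: k => [|k IHk]; first by rewrite P_S P_0.
  by rewrite (P_S k.+1) {2}P_S; apply: robust_pred_mono.
split; first by move=> k; split; [exact: M_sub | exact: P_decr].
apply/seteqP; split; first by move=> x Mx k _; apply: M_sub.
apply: M_greatest; first by move=> x /(_ 0%N I); rewrite P_0 => /P_sub_X.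
rewrite robust_pred_bigcap; last by exists 0%N.
rewrite -[RHS](bigcap_shift _ _ P_decr).
by apply: eq_bigcapr => k _; rewrite P_S.
Qed.
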